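(* Let $\mu<\kappa<\chi<{\rm Ded}^+(\mu)$ and $2^\mu<\lambda$ be cardinals, with $\kappa$ regular and $\lambda\le{\bf U}_{J^{\rm bd}_\kappa}(\chi)$. Then ${\rm Ens}(\kappa,\lambda)$ holds, witnessed by a sequence $\langle{\mathcal I}_\alpha:\alpha<\lambda\rangle$ of linear orders each of cardinality $\kappa$ and density $\mu$.
   Context: $J^{\rm bd}_\kappa$ is the ideal of bounded subsets of $\kappa$. For an ideal $J$ on $\kappa$, ${\bf U}_J(\chi)$ is the minimal cardinality of a family ${\mathcal A}\subseteq[\chi]^\kappa$ such that for every $f:\kappa\to\chi$ there is $A\in{\mathcal A}$ with $\{i<\kappa:f(i)\in A\}\notin J$. ${\rm Ded}^+(\mu)$ is the least cardinal $\theta$ such that there is no linear order with $\theta$ elements and density $\le\mu$ (the density of a linear order being the least cardinality of a dense subset). A sequence $\langle{\mathcal I}_\alpha:\alpha<\alpha^*\rangle$ of linear orders is entangled if, with $\kappa'=\min\{|{\mathcal I}_\alpha|:\alpha<\alpha^*\}$: each ${\mathcal I}_\alpha$ has cardinality $\ge\kappa'$, and whenever $n<\omega$, $\alpha_1<\dots<\alpha_n<\alpha^*$, and $t^\ell_\zeta\in{\mathcal I}_{\alpha_\ell}$ ($1\le\ell\le n$, $\zeta<\kappa'$) satisfy $\zeta\ne\xi\Rightarrow t^\ell_\zeta\ne t^\ell_\xi$, then for every $w\subseteq\{1,\dots,n\}$ there are $\zeta<\xi<\kappa'$ with $t^\ell_\zeta<t^\ell_\xi$ in ${\mathcal I}_{\alpha_\ell}$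 for $\ell\in w$ and $t^\ell_\xi<t^\ell_\zeta$ in ${\mathcal I}_{\alpha_\ell}$ for $\ell\in\{1,\dots,n\}\setminus w$. ${\rm Ens}(\kappa,\lambda)$ is the statement that there is an entangled sequence $\langle{\mathcal I}_\alpha:\alpha<\lambda\rangle$ of linear orders each of cardinality $\kappa$. *)

(* Defs.v *)
From HB Require Import structures.
From mathcomp Require Import all_boot all_order.
From mathcomp Require Import boolp classical_sets functions cardinality wochoice.

Set Implicit Arguments.
Unset Strict Implicit.
Unset Printing Implicit Defensive.

Import Order.TTheory.

Local Open Scope classical_set_scope.
Local Open Scope card_scope.
Local Open Scope order_scope.

Definition card_lt (T U : Type) (A : set T) (B : set U) : Prop :=
  (A #<= B) /\ ~ (B #<= A).
Notation "A '#<' B" := (card_lt A B)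
  (at level 79, format "A  '#<'  B") : card_scope.

(* The display is immaterial; it is fixed so that families of linear orders
   can be given a type. *)
Notation linorder := (orderType (Order.Disp tt tt)).

(* Cardinals are initial ordinals, as in ZFC: a well-order none of whose proper
   initial segments is equipotent with the whole.  Two cardinals are equal, as
   cardinals, when [set: c] #= [set: c']. *)
Record cardinal := Cardinal {
  cardinal_ord :> linorder;
  cardinal_wo : well_order (<=%O : rel cardinal_ord);
  cardinal_initial : forall a : cardinal_ord,
    ~ ([set: cardinal_ord] #<= [set x : cardinal_ord | x < a])
}.

Lemma cardleP (T U : Type) :
  reflect (exists f : T -> U, injective f) ([set: T] #<= [set: U]).
Proof.
have inT (A : Type) (x : A) : x \in [set: A] by apply/mem_set.
apply: (iffP card_leP) => [[f]|[f fi]].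
  exists (fun x => val (f (exist _ x (inT T x)))) => x y /val_inj fxy.
  have := @inj _ _ _ f (exist _ x (inT T x)) (exist _ y (inT T y)) (inT _ _) (inT _ _) fxy.
  by move=> /(congr1 val).
apply/injfunPex; exists (fun x : [set: T] => exist _ (f (val x)) (inT U _)) => //.
by move=> x y _ _ /(congr1 val)/= /fi/val_inj.
Qed.

Set Warnings "-redundant-canonical-projection".
Section WoType.
Variables (T : Type) (R : rel T) (anti : antisymmetric R) (trans : transitive R)
  (tot : total R).
Definition wo_type (_ : antisymmetric R) (_ : transitive R) (_ : total R) := T.
Local Notation W := (wo_type anti trans tot).
HB.instance Definition _ := gen_eqMixin W.
HB.instance Definition _ := gen_choiceMixin W.
HB.instance Definition _ := @Order.isOrder.Build (Order.Disp tt tt) W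
  R (fun x y => (y != x :> W) && R x y) _ _
  (fun _ _ => erefl) (fun _ _ => erefl) (fun _ _ => erefl) anti trans tot.
End WoType.

Lemma cardinal_of_wo (T : choiceType) (R : rel T) : well_order R ->
  (forall a, ~ ([set: T] #<= [set x | x <> a /\ R x a])) ->
  exists c : cardinal, [set: T] #= [set: c].
Proof.
move=> wR init.
have wc : wo_chain R predT by move=> A _; exact: wR.
have tot : total R by move=> x y; exact: (wo_chainW wc).
have anti : antisymmetric R.
  by move=> x y; apply: (wo_chain_antisymmetric wc).
have trans : transitive R.
  move=> y x z xy yz.
  have [|m [[]]] := wR (fun t => [|| t == x, t == y | t == z]).
    by exists x; rewrite unfold_in eqxx.
  rewrite unfold_in => + mlb _.
  have [mx my mz] : [/\ R m x, R m y & R m z].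
    by split; apply: mlb; rewrite unfold_in eqxx ?orbT.
  case/or3P => /eqP e; subst m => //.
    by rewrite (anti x y) ?xy.
  by rewrite -(anti y z) ?yz.
pose I : linorder := wo_type anti trans tot.
have w : well_order (<=%O : rel I) by exact: wR.
have ini (a : I) : ~ ([set: I] #<= [set x : I | x < a]).
  suff -> : [set x : I | x < a] = [set x : T | x <> a /\ R x a].
    exact: init.
  apply/seteqP; split=> x /=; rewrite lt_def.
    by move=> /andP[/eqP ax xa]; split=> // xa'; apply: ax.
  by move=> [xa Rxa]; apply/andP; split=> //; apply/eqP => ax; apply: xa.
by exists (Cardinal w ini); exact: card_eqxx.
Qed.

Lemma cardinal_exists (T : Type) : exists c : cardinal, [set: T] #= [set: c].
Proof.
pose T' : choiceType := {classic T}.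
have [R wR] := @well_ordering_principle T'.
pose B a := [set x : T' | x <> a /\ R x a].
have [H|] := pselect (forall a, ~ ([set: T'] #<= B a)).
  exact: (cardinal_of_wo wR H).
move=> /existsNP[a0 /contrapT a0P].
have [|a [[aP alb] _]] := wR (fun a => `[< [set: T'] #<= B a >]).
  by exists a0; apply/asboolP.
move: aP => /asboolP aP.
pose S : choiceType := set_type (B a).
have wS : well_order (relpre (val : S -> T') R).
  move=> A [x Ax].
  have [|m [[mA mlb] mu]] := wR (fun y => `[< exists2 s : S, s \in A & val s = y >]).
    by exists (val x); apply/asboolP; exists x.
  move: (mA) => /asboolP[s sA sm]; exists s; split.
    by split=> // y yA /=; rewrite sm; apply: mlb; apply/asboolP; exists y.
  move=> s' [s'A s'lb]; apply: val_inj; rewrite sm; apply: mu; split.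
    by apply/asboolP; exists s'.
  by move=> _ /asboolP[y yA <-]; exact: s'lb.
have TS : [set: T'] #= [set: S].
  apply/card_eqPle; split; last by apply/cardleP; exists val; exact: val_inj.
  by rewrite (card_le_eqr (card_setT _)).
have [|c Sc] := @cardinal_of_wo S (relpre val R) wS; last first.
  by exists c; exact: card_eq_trans Sc.
move=> b Sb.
have [ba Rba] : B a (val b) by exact/set_mem/valP.
have Rab : R a (val b).
  apply: alb; apply/asboolP.
  rewrite (card_le_eql TS); apply: card_le_trans Sb _.
  rewrite -(card_le_eql (card_setT _)) -(card_le_eqr (card_setT _)).
  apply/cardleP.
  have h (x : set_type [set x : S | x <> b /\ relpre val R x b]) :
      val (val x) \in B (val b).
    apply/mem_set; have /set_mem[xb Rxb] := valP x.
    by split=> // /val_inj.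
  by exists (fun x => exist (fun y => y \in B (val b)) _ (h x)) => x y /(congr1 val)/= /val_inj/val_inj.
have wc : wo_chain R predT by move=> A _; exact: wR.
apply: ba.
by apply: (wo_chain_antisymmetric wc) => //; rewrite Rba Rab.
Qed.

Lemma min_type (I : Type) (X : I -> Type) :
  inhabited I -> exists i, forall j, exists f : X i -> X j, injective f.
Proof.
move=> [i0].
pose P (F : set (forall i, X i)) :=
  forall f g, F f -> F g -> (exists i, f i = g i) -> f = g.
have [|A [PA Amax]] := @Zorn_bigcup _ P.
  move=> F FP Ftot f g [A FA Af] [B FB Bg].
  by have [AB|BA] := Ftot _ _ FA FB; [apply: (FP B)|apply: (FP A)] => //;
    [exact: AB|exact: BA].
have [i iP] : exists i, forall x : X i, exists f, A f /\ f i = x.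
  apply: contrapT => /forallNP H.
  have {}H i : exists x : X i, forall f, A f -> f i <> x.
    have /existsNP[x xP] := H i; exists x => f Af fx; apply: xP.
    by exists f.
  pose h i := projT1 (cid (H i)).
  have hP i f : A f -> f i <> h i by exact: (projT2 (cid (H i))).
  apply: (Amax (A `|` [set h])).
    split; first by move=> f Af; left.
    by move=> /(_ h (or_intror erefl)) Ah; exact: (hP i0 h Ah).
  move=> f g [Af|->] [Ag|->] // [i fg]; first by apply: PA => //; exists i.
    by case: (hP i f Af).
  by case: (hP i g Ag).
exists i => j; pose s x := projT1 (cid (iP x)).
have sA x : A (s x) by have [] := projT2 (cid (iP x)).
have sx x : s x i = x by have [] := projT2 (cid (iP x)).
exists (fun x => s x j) => x y sxy.
by rewrite -(sx x) -(sx y) (PA (s x) (s y))//; exists j.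
Qed.

(* Arbitrary when no cardinal satisfies P; otherwise least_cardP applies. *)
Definition least_card (P : cardinal -> Prop) : cardinal :=
  match pselect (exists c, P c /\ forall c', P c' -> [set: c] #<= [set: c'])
  with
  | left h => projT1 (cid h)
  | right _ => projT1 (cid (cardinal_exists void))
  end.

Lemma least_cardP (P : cardinal -> Prop) : (exists c, P c) ->
  P (least_card P) /\
  forall c, P c -> [set: least_card P] #<= [set: c].
Proof.
move=> [c0 Pc0]; rewrite /least_card; case: pselect => [h|].
  exact: (projT2 (cid h)).
case.
pose I := {A : set c0 | exists c, P c /\ [set: c] #= A}.
have [|A Amin] := @min_type I (fun A => set_type (projT1 A)).
  by constructor; exists setT; exists c0.
have [c [Pc cA]] := projT2 A; exists c; split=> // c' Pc'.
have [b bmin] := @min_type bool (fun b => if b then c0 else c') (inhabits true).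
have Ac0 : projT1 A #<= [set: c0].
  rewrite -(card_le_eql (card_setT _)); apply/cardleP.
  by exists val; exact: val_inj.
rewrite (card_le_eql cA).
case: b bmin => bmin.
  by apply: card_le_trans Ac0 _; apply/cardleP; exact: bmin false.
have : [set: c'] #<= [set: c0] by apply/cardleP; exact: bmin true.
move=> /card_subP[B Bc' _].
have hB : exists c, P c /\ [set: c] #= B by exists c'; split=> //; exact: card_esym.
rewrite -(card_le_eqr Bc') -(card_le_eql (card_setT _)) -(card_le_eqr (card_setT _)).
apply/cardleP; exact: (Amin (exist _ B hB)).
Qed.

Section LinearOrders.
Context {d : Order.disp_t}.

(* The order-theoretic notion, not density for the order topology: some element
   of D lies in each closed interval [x, y] with x < y, jumps included. *)
Definition dense_subset (I : orderType d) (D : set I) : Prop :=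
  forall x y : I, x < y -> exists z : I, [/\ D z, x <= z & z <= y].

Definition density (I : orderType d) : cardinal :=
  least_card (fun c => exists D : set I, dense_subset D /\ D #= [set: c]).

Definition bounded_ideal (k : orderType d) : set (set k) :=
  [set A | exists b : k, forall a : k, A a -> a < b].

(* Above, bounded means strictly bounded, so that in an infinite cardinal
   (a limit ordinal) unbounded and cofinal sets agree. *)
Definition cofinality (k : orderType d) : cardinal :=
  least_card (fun c =>
    exists A : set k, ~ bounded_ideal A /\ A #= [set: c]).

End LinearOrders.

Arguments bounded_ideal {d} k.

Definition regular_card (k : cardinal) : Prop :=
  infinite_set [set: k] /\ [set: cofinality k] #= [set: k].

Definition Ded_plus (mu : cardinal) : cardinal :=
  least_card (fun theta =>
    ~ exists I : linorder,
        [set: I] #= [set: theta] /\ [set: density I] #<= [set: mu]).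

Definition UJ (k : cardinal) (J : set (set k)) (chi : cardinal) : cardinal :=
  least_card (fun c => exists AA : set (set chi),
    [/\ forall A, AA A -> A #= [set: k],
        forall f : k -> chi, exists A, AA A /\ ~ J [set i | A (f i)]
      & AA #= [set: c]]).

(* The index order a plays the role of the ordinal alpha-star; the definition
   makes sense for any linear order of indices. *)
Definition entangled (d : Order.disp_t) (a : orderType d) (I : a -> linorder)
    : Prop :=
  let k' := least_card (fun c => exists al : a, [set: I al] #= [set: c]) in
  (forall al : a, [set: k'] #<= [set: I al]) /\
  forall (n : nat) (al : 'I_n -> a) (t : forall l : 'I_n, k' -> I (al l)),
    (forall l m : 'I_n, (l < m)%N -> al l < al m) ->
    (forall (l : 'I_n) (zeta xi : k'), zeta <> xi -> t l zeta <> t l xi) ->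
    forall w : {set 'I_n}, exists zeta xi : k',
      [/\ zeta < xi,
          forall l : 'I_n, l \in w -> t l zeta < t l xi
        & forall l : 'I_n, l \notin w -> t l xi < t l zeta].

Definition Ens_witness (k lam : cardinal) (I : lam -> linorder) : Prop :=
  (forall al : lam, [set: I al] #= [set: k]) /\ entangled I.

Definition Ens (k lam : cardinal) : Prop :=
  exists I : lam -> linorder, Ens_witness k I.

(* Main.v *)
(** The order [I] of size [chi] has a separating family [P] of mu many cuts.
    There are [2^mu] partial functions from finite sequences of points to points
    that are coded by a set of finite sequences of cuts ([decode]).  By recursion on
    [al < lambda] one finds [f al : kappa -> I] that meets, on a bounded set of
    indices only, every image under one of these functions of finitely many
    earlier ranges; this is possible since each image has size at most [kappa]
    and fewer than [lambda <= U] of them are in play.  The order with index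
    [al] is the range of [f al], followed by mu many jumps which force its
    density to be exactly [mu].

    If a pattern [w] were omitted by [t l z] (l <= n, z < kappa), let [R] be the
    set of pairs (box in the first coordinates, cut in the last one) realised by
    some index; mu many indices realise all of them.  For all later [z] outside
    a small set, omission of [w] implies that the last point is decoded from
    the others by [R], contrary to the choice of the last [f al].  The small
    set is controlled by induction on the number of coordinates. *)
From HB Require Import structures.
Require Import Defs.
From mathcomp Require Import all_boot all_order.
From mathcomp Require Import boolp classical_sets functions cardinality wochoice.

Set Implicit Arguments.
Unset Strict Implicit.
Unset Printing Implicit Defensive.

Import Order.TTheory.

Local Open Scope classical_set_scope.
Local Open Scope card_scope.
Local Open Scope order_scope.

(** * Comparison of cardinalities by injections *)

Definition leT (A B : Type) := exists f : A -> B, injective f.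

Lemma leTP (A B : Type) : leT A B <-> [set: A] #<= [set: B].
Proof. by split=> [/cardleP|/cardleP]. Qed.

Lemma leT_refl A : leT A A.
Proof. by exists id. Qed.

Lemma leT_trans B A C : leT A B -> leT B C -> leT A C.
Proof. by move=> [f fi] [g gi]; exists (g \o f); exact: inj_comp. Qed.

Lemma leT_total A B : leT A B \/ leT B A.
Proof.
have [[] h] := @min_type bool (fun b => if b then A else B) (inhabits true).
  by left; exact: (h false).
by right; exact: (h true).
Qed.

Lemma leT_prod A B A' B' : leT A A' -> leT B B' -> leT (A * B) (A' * B').
Proof.
move=> [f fi] [g gi]; exists (fun x => (f x.1, g x.2)).
by move=> [a b] [a' b'] /= [/fi -> /gi ->].
Qed.

Lemma leT_sum A B A' B' : leT A A' -> leT B B' -> leT (A + B) (A' + B').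
Proof.
move=> [f fi] [g gi].
exists (fun x => match x with inl a => inl (f a) | inr b => inr (g b) end).
by move=> [a|a] [b|b] //= [] => [/fi|/gi] ->.
Qed.

Lemma leT_seq A B : leT A B -> leT (seq A) (seq B).
Proof. by move=> [f fi]; exists (map f); exact: inj_map. Qed.

Lemma leT_countType (A : countType) : leT A nat.
Proof. by exists pickle; exact: (pcan_inj pickleK). Qed.

Definition set_elt T (A : set T) x (Ax : A x) : set_type A :=
  exist (fun y => y \in A) x (mem_set Ax).

Lemma leT_set_type T (A : set T) : leT (set_type A) T.
Proof. by exists val; exact: val_inj. Qed.

Lemma leT_subset T (A B : set T) : A `<=` B -> leT (set_type A) (set_type B).
Proof.
move=> AB; have h (x : set_type A) : B (val x) by apply/AB/set_mem/valP.
by exists (fun x => set_elt (h x)) => x y /(congr1 val)/= /val_inj.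
Qed.

Lemma leT_range A B C (f : A -> B) : leT A C -> leT (set_type (range f)) C.
Proof.
move=> leAC; apply: leT_trans leAC.
have h (x : set_type (range f)) : exists a, f a = val x.
  by have /set_mem[a _ fa] := valP x; exists a.
exists (fun x => projT1 (cid (h x))) => x y e; apply: val_inj.
by rewrite -(projT2 (cid (h x))) e (projT2 (cid (h y))).
Qed.

Lemma leT_range_inj A B (f : A -> B) : injective f -> leT A (set_type (range f)).
Proof.
move=> fi; have h a : range f (f a) by exists a.
by exists (fun a => set_elt (h a)) => a b /(congr1 val)/= /fi.
Qed.

Lemma leT_setU T (A B : set T) :
  leT (set_type (A `|` B)) (set_type A + set_type B).
Proof.
have h (x : set_type (A `|` B)) :
    exists z : set_type A + set_type B,
    match z with inl a => val a | inr b => val b end = val x.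
  have /set_mem[xA|xB] := valP x; first by exists (inl (set_elt xA)).
  by exists (inr (set_elt xB)).
exists (fun x => projT1 (cid (h x))) => x y e; apply: val_inj.
by rewrite -(projT2 (cid (h x))) e (projT2 (cid (h y))).
Qed.

Lemma leT_sum_double W : leT (W + W) (bool * W).
Proof.
exists (fun x => match x with inl a => (true, a) | inr a => (false, a) end).
by move=> [a|a] [b|b] //= [->].
Qed.

Lemma leT_double W : leT (W * W) W -> leT nat W -> leT (W + W) W.
Proof.
move=> WW NW; apply: leT_trans (leT_sum_double W) _.
apply: leT_trans WW; apply: leT_prod (leT_refl W).
exact: leT_trans (leT_countType bool) NW.
Qed.

(** * The square of an infinite set *)

Section Square.
Variable T : Type.
Implicit Types (G : set (T * T * T)).

(** The underlying set is read off the diagonal, so that Zorn's lemma can run over sets of triples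
    alone. *)
Let field G : set T := [set x | exists y, G (x, x, y)].

(* G is the graph of an injection [field G * field G -> field G]. *)
Let partial_sq G := [/\
  forall a b c, G (a, b, c) -> [/\ field G a, field G b & field G c],
  forall a b, field G a -> field G b -> exists c, G (a, b, c),
  forall a b c c', G (a, b, c) -> G (a, b, c') -> c = c' &
  forall a b a' b' c, G (a, b, c) -> G (a', b', c) -> a = a' /\ b = b'].

Let partial_sq_bigcup (F : set (set (T * T * T))) :
  F `<=` partial_sq -> total_on F subset -> partial_sq (\bigcup_(X in F) X).
Proof.
move=> FP Ft.
have fieldU X a : F X -> field X a -> field (\bigcup_(X in F) X) a.
  by move=> FX [y Xy]; exists y, X.
have two a b : (\bigcup_(X in F) X) a -> (\bigcup_(X in F) X) b ->
    exists X, [/\ F X, X a & X b].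
  move=> [X FX Xa] [Y FY Yb].
  by have [XY|YX] := Ft _ _ FX FY; [exists Y|exists X]; split=> //; [exact: XY|exact: YX].
split.
- move=> a b c [X FX Xabc]; have [h _ _ _] := FP _ FX.
  by have [? ? ?] := h _ _ _ Xabc; split; exact: (fieldU X).
- move=> a b [y hy] [z hz]; have [X [FX Xa Xb]] := two _ _ hy hz.
  have [_ h _ _] := FP _ FX.
  have [|| c Xc] := h a b; [by exists y|by exists z|].
  by exists c, X.
- move=> a b c c' h1 h2; have [X [FX Xa Xb]] := two _ _ h1 h2.
  by have [_ _ h _] := FP _ FX; exact: h Xa Xb.
- move=> a b a' b' c h1 h2; have [X [FX Xa Xb]] := two _ _ h1 h2.
  by have [_ _ _ h] := FP _ FX; exact: h Xa Xb.
Qed.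

(** Old pairs keep their values; every other pair of the enlarged set is sent by [h] into [B], which
    misses the old values, so injectivity survives. *)
Let partial_sq_extend G (B : set T) : partial_sq G ->
  B !=set0 -> (forall x, B x -> ~ field G x) ->
  leT (set_type (field G `|` B) * set_type (field G `|` B)) (set_type B) ->
  exists2 G', G `<` G' & partial_sq G'.
Proof.
move=> [P1 P2 P3 P4] [b0 Bb0] Bdisj [h hi].
pose G' : set (T * T * T) := [set t | G t \/
  ~ (field G t.1.1 /\ field G t.1.2) /\
  exists u v : set_type (field G `|` B),
    [/\ val u = t.1.1, val v = t.1.2 & val (h (u, v)) = t.2]].
have hB u v : B (val (h (u, v))) by exact/set_mem/valP.
have new (u v : set_type (field G `|` B)) : ~ (field G (val u) /\ field G (val v)) ->
    G' (val u, val v, val (h (u, v))).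
  by move=> nuv; right; split=> //; exists u, v.
have UG' (u : set_type (field G `|` B)) : field G' (val u).
  have [[y Gy]|nu] := pselect (field G (val u)); first by exists y; left.
  by exists (val (h (u, u))); apply: new; case.
have G'U x : field G' x -> (field G `|` B) x.
  move=> [y [Gy|[_ /= [u [_ [<- _ _]]]]]]; first by left; exists y.
  exact/set_mem/valP.
have inU x : (field G `|` B) x -> exists u : set_type (field G `|` B), val u = x.
  by move=> xU; exists (set_elt xU).
have UG'x x : (field G `|` B) x -> field G' x.
  by move=> /inU[u <-]; exact: UG'.
exists G'.
  split; first by move=> t Gt; left.
  move=> /(_ (_, _, _)) /= sub; have [u ub0] := inU b0 (or_intror Bb0).
  have nb0 := Bdisj _ Bb0.
  have /sub/P1[] : G' (val u, val u, val (h (u, u))) by apply: new; rewrite ub0 => -[].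
  by rewrite ub0.
split.
- move=> a b c [/P1[fa fb fc]|[_ /= [u [v [<- <- <-]]]]].
    by split; apply: UG'x; left.
  by split; [exact: UG'|exact: UG'|by apply: UG'x; right; exact: hB].
- move=> a b /G'U Ua /G'U Ub; have [[fa fb]|nab] := pselect (field G a /\ field G b).
    by have [c Gc] := P2 _ _ fa fb; exists c; left.
  have [[u ua] [v vb]] := (inU _ Ua, inU _ Ub).
  by exists (val (h (u, v))); rewrite -ua -vb; apply: new; rewrite ua vb.
- move=> a b c c' [Gc|[nab /= [u [v [ua vb <-]]]]] [Gc'|[nab' /= [u' [v' [ua' vb' <-]]]]].
  + exact: P3 Gc Gc'.
  + by case: nab'; have [] := P1 _ _ _ Gc.
  + by case: nab; have [] := P1 _ _ _ Gc'.
  + have -> : u = u' by exact/val_inj/(etrans ua (esym ua')).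
    by have -> : v = v' by exact/val_inj/(etrans vb (esym vb')).
- move=> a b a' b' c [Gc|[nab /= [u [v [ua vb hc]]]]] [Gc'|[nab' /= [u' [v' [ua' vb' hc']]]]].
  + exact: P4 Gc Gc'.
  + by have [_ _] := P1 _ _ _ Gc; rewrite -hc' => /(Bdisj _ (hB _ _)).
  + by have [_ _] := P1 _ _ _ Gc'; rewrite -hc => /(Bdisj _ (hB _ _)).
  + have /val_inj/hi[uu vv] : val (h (u, v)) = val (h (u', v')) by exact: etrans hc (esym hc').
    by rewrite -ua -vb -ua' -vb' uu vv.
Qed.

Let partial_sq_le G : partial_sq G ->
  leT (set_type (field G) * set_type (field G)) (set_type (field G)).
Proof.
move=> [P1 P2 P3 P4].
have h (x : set_type (field G) * set_type (field G)) :
    exists c : set_type (field G), G (val x.1, val x.2, val c).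
  have [c Gc] := P2 _ _ (set_mem (valP x.1)) (set_mem (valP x.2)).
  by have [_ _ fc] := P1 _ _ _ Gc; exists (set_elt fc).
exists (fun x => projT1 (cid (h x))) => -[a b] [a' b'] e.
have := projT2 (cid (h (a, b))); rewrite e => h1.
have [/= /val_inj -> /val_inj ->] := P4 _ _ _ _ _ h1 (projT2 (cid (h (a', b')))).
by [].
Qed.

(** Let [A] be the field of a maximal partial squaring. By [noext] the complement of [A] contains no
    copy of an infinite idempotent [W] that dominates [A]. For infinite [A], taking [W = A] forces
    [T] to embed in [A]; for finite [A], taking [W = nat] is contradictory. *)
Lemma leT_square : leT nat T -> leT (T * T) T.
Proof.
move=> NT; have [G [PG Gmax]] := Zorn_bigcup partial_sq_bigcup.
set A := field G.
have noext W : leT (W * W) W -> leT nat W -> leT (set_type A) W -> leT W (set_type (~` A)) ->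
    False.
  move=> WW NW AW [j ji].
  pose B := range (fun w => val (j w)).
  have WB : leT W (set_type B) by apply: leT_range_inj => x y /val_inj/ji.
  have BW : leT (set_type B) W by apply: leT_range; exact: leT_refl.
  have [|||G' GG' PG'] := @partial_sq_extend G B PG; last exact: Gmax GG' PG'.
  - by have [n _] := NW; exists (val (j (n 0%N))), (n 0%N).
  - by move=> _ [w _ <-]; exact: (set_mem (valP (j w))).
  - apply: leT_trans WB; apply: (leT_trans _ WW).
    have U : leT (set_type (A `|` B)) W.
      apply: leT_trans (leT_setU _ _) _.
      exact: leT_trans (leT_sum AW BW) (leT_double WW NW).
    exact: leT_prod.
have TA : leT T (set_type A + set_type (~` A)).
  apply: leT_trans (leT_setU _ _); rewrite setUv.
  by exists (fun x => @set_elt _ setT x I) => x y /(congr1 val).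
have AA := partial_sq_le PG.
have [NA|nNA] := pselect (leT nat (set_type A)).
  have [leAC|CA] := leT_total (set_type A) (set_type (~` A)).
    by case: (noext (set_type A)) => //; exact: leT_refl.
  have {}TA : leT T (set_type A).
    apply: leT_trans TA _; apply: leT_trans (leT_double AA NA).
    exact: leT_sum (leT_refl _) CA.
  exact: leT_trans (leT_prod TA TA) (leT_trans AA (leT_set_type A)).
have finA : finite_set A.
  by apply/finite_setPn; rewrite -(card_le_eqr (card_setT A)) => /leTP.
case: (noext nat) => //.
- exact: leT_countType.
- exact: leT_refl.
- apply/leTP; rewrite (card_le_eql (card_setT A)).
  exact: finite_set_countable.
- apply/leTP; rewrite (card_le_eqr (card_setT _)); apply/infiniteP.
  rewrite -setTD; apply: infinite_setD => //.
  by apply/infiniteP/leTP.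
Qed.

End Square.

Lemma leT_prod_absorb A B T : leT nat T -> leT A T -> leT B T -> leT (A * B) T.
Proof.
by move=> NT AT BT; apply: leT_trans (leT_prod AT BT) (leT_square NT).
Qed.

Lemma leT_sum_absorb A B T : leT nat T -> leT A T -> leT B T -> leT (A + B) T.
Proof.
move=> NT AT BT; apply: leT_trans (leT_sum AT BT) _.
exact: leT_double (leT_square NT) NT.
Qed.

Lemma leT_seq_absorb A T : leT nat T -> leT A T -> leT (seq A) T.
Proof.
move=> NT /leT_seq AT; apply: leT_trans AT _.
have [p pi] := leT_square NT; have [n _] := NT.
apply: leT_trans (leT_prod_absorb NT NT (leT_refl T)).
(* Entries are merged by iterated pairing from an arbitrary start [n 0%N]; the recorded length makes
   this decodable. *)
exists (fun s => (size s, foldr (fun x c => p (x, c)) (n 0%N) s)).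
elim=> [|x s IH] [|y s'] //= -[es /pi[-> ef]].
by rewrite (IH s') // es ef.
Qed.

(** * Smallness relative to a regular cardinal *)

Section Small.
Variable k : cardinal.

(** Unlike unboundedness this makes sense in every type; for subsets of a regular [k] the two
    agree. *)
Definition big T (A : set T) := exists2 g : k -> T, injective g & forall i, A (g i).

Lemma big_inj T U (A : set T) (B : set U) (h : T -> U) :
  {in A &, injective h} -> (forall x, A x -> B (h x)) -> big A -> big B.
Proof.
move=> hi hAB [g gi gA]; exists (h \o g) => [i j /= e|i]; last exact/hAB.
by apply/gi/hi => //; exact/mem_set.
Qed.

Lemma big_sub T (A B : set T) : A `<=` B -> big A -> big B.
Proof. by move=> AB; apply: (@big_inj _ _ _ _ id) => //. Qed.

Lemma big_leT T (A : set T) : big A <-> leT k (set_type A).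
Proof.
split=> [[g gi gA]|[g gi]].
  by exists (fun i => set_elt (gA i)) => i j /(congr1 val)/= /gi.
by exists (val \o g) => [i j /= /val_inj/gi|i] //=; exact: (set_mem (valP (g i))).
Qed.

Lemma bounded_small (c : cardinal) (b : c) : leT c k -> ~ big [set x | x < b].
Proof.
move=> ck /big_leT kb; apply: (@cardinal_initial c b).
rewrite -(card_le_eqr (card_setT _)); apply/leTP; exact: leT_trans ck kb.
Qed.

Hypothesis kreg : regular_card k.

Lemma regular_infinite : leT nat k.
Proof. by apply/leTP/infiniteP; have [] := kreg. Qed.

(** An unbounded set competes in the minimum defining the cofinality, which is [k] by regularity. *)
Lemma small_bounded (A : set k) : ~ big A -> bounded_ideal k A.
Proof.
move=> nA; apply: contrapT => nb; apply: nA; apply/big_leT.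
have [c Ac] := cardinal_exists (set_type A).
have Ac' : A #= [set: c] by exact: card_eq_trans (card_esym (card_setT A)) Ac.
have [|_ cofmin] := @least_cardP (fun c => exists A : set k, ~ bounded_ideal k A /\ A #= [set: c]).
  by exists c, A.
have /leTP cof := cofmin c (ex_intro _ A (conj nb Ac')).
have [_ /card_eqPle[_ /leTP kc]] := kreg.
apply: leT_trans kc (leT_trans cof _).
by move: Ac => /card_eqPle[_ /leTP].
Qed.

(** Inside an injective copy of [k] each piece is bounded, and by regularity so are the fewer than
    [k] bounds; an index [c] above all of them lies in no piece. *)
Lemma small_bigcup T (E : Type) (S : E -> set T) : ~ leT k E ->
  (forall e, ~ big (S e)) -> ~ big [set x | exists e, S e x].
Proof.
move=> nkE small [g gi gS].
have bd e : exists b, forall i, S e (g i) -> i < b.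
  have [|b bP] := @small_bounded [set i | S e (g i)]; last by exists b.
  by move=> /(@big_inj _ _ _ (S e) g) H; apply: (small e); apply: H => // ? ? _ _; exact: gi.
pose b e := projT1 (cid (bd e)).
have [|c cP] := @small_bounded (range b).
  by move=> /big_leT kb; apply: nkE; apply: leT_trans kb (leT_range _ (leT_refl E)).
have [e /(projT2 (cid (bd e)))] := gS c.
have bec : b e < c by apply: cP; exists e.
by move=> /(lt_trans bec); rewrite ltxx.
Qed.

Lemma bool_lt_regular : ~ leT k bool.
Proof.
move=> /(leT_trans regular_infinite)/leTP H.
suff /infiniteP : [set: nat] #<= [set: bool] by apply; exact: finite_finset.
exact: H.
Qed.

Lemma small_setU T (A B : set T) : ~ big A -> ~ big B -> ~ big (A `|` B).
Proof.
move=> nA nB H.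
apply: (@small_bigcup T bool (fun e => if e then A else B)) => [||].
- exact: bool_lt_regular.
- by case.
- by apply: big_sub H => x [] ?; [exists true|exists false].
Qed.

Lemma small_set1 T (x : T) : ~ big [set x].
Proof.
move=> [g gi gx]; apply: bool_lt_regular; exists (fun=> true) => i j _.
by apply: gi; rewrite gx gx.
Qed.

Lemma big_setI_compl T (A B : set T) : big A -> ~ big B -> big (A `\` B).
Proof.
move=> bA nB; apply: contrapT => nD; apply: (small_setU nB nD).
by apply: big_sub bA => x Ax; have [Bx|nBx] := pselect (B x); [left|right].
Qed.

(** Stated for a [c] equipotent with [k], because the minimal cardinal in [entangled] need not be
    [k] itself. If the image were unbounded, [c] would be a union of fewer than [k] small initial
    segments. *)
Lemma small_image_bounded (c : cardinal) (E : Type) (h : E -> c) :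
  leT k c -> leT c k -> ~ leT k E -> exists b, forall e, h e < b.
Proof.
move=> [g gi] ck nkE; apply: contrapT => nb.
apply: (@small_bigcup c E (fun e => [set y | y < h e] `|` [set h e])) => //.
  by move=> e; apply: small_setU; [exact: bounded_small|exact: small_set1].
exists g => // i; apply: contrapT => /forallNP H; apply: nb; exists (g i) => e.
have /not_orP[] := H e; rewrite /= => /negP; rewrite -leNgt le_eqVlt.
by case/orP => // /eqP -> /(_ erefl).
Qed.

Lemma preimage_small_inj T (g : k -> T) :
  (forall y, ~ big [set i | g i = y]) -> leT k (set_type (range g)).
Proof.
move=> small; apply: contrapT => nk.
apply: (small_bigcup nk (S := fun y => [set i | g i = val y])) => //.
exists id => // i; have gi : range g (g i) by exists i.
by exists (set_elt gi).
Qed.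

End Small.

(** * Cuts and the partial functions they code *)

Lemma all2_map_r S T U (r : S -> U -> bool) (h : T -> U) s t :
  all2 r s (map h t) = all2 (fun x y => r x (h y)) s t.
Proof. by elim: s t => [|x s IH] [|y t] //=; rewrite IH. Qed.

Section Cuts.
Variables (I : linorder) (E : Type) (P : E -> I -> bool).
Hypothesis Pdown : forall c x y, x <= y -> P c y -> P c x.
Hypothesis Psep : forall x y, x < y -> exists2 c, P c x & ~~ P c y.

Definition sat (q : E * bool) x := P q.1 x == q.2.

Lemma cut_lt c x y : P c x -> ~~ P c y -> x < y.
Proof. by move=> Px; apply: contraNT; rewrite -leNgt => /Pdown; exact. Qed.

(* A code [p] defines a partial function from finite sequences of points to
   points: a cut is on the side [p.1] of the value exactly when some
   box paired with it by [p.2] has all its conditions violated by the arguments. *)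
Definition code := (bool * (seq (E * bool) * E -> bool))%type.

Definition decode (p : code) (xs : seq I) (y : I) := forall c,
  P c y == p.1 <->
  exists cs, p.2 (cs, c) /\ all2 (fun q x => ~~ sat q x) cs xs.

(** The right-hand side of [decode] does not mention the value, so two values lie on the same side
    of every cut, and separation makes them equal. *)
Lemma decode_inj p xs y y' : decode p xs y -> decode p xs y' -> y = y'.
Proof.
have nlt y1 y2 : decode p xs y1 -> decode p xs y2 -> ~ y1 < y2.
  move=> d1 d2 /Psep[c Pc nPc].
  have : P c y1 == p.1 <-> P c y2 == p.1.
    by split=> [/d1/d2|/d2/d1].
  by rewrite Pc (negbTE nPc); case: p.1 => -[h1 h2]; [have := h1 erefl|have := h2 erefl].
by move=> d d'; case: (ltgtP y y') => // h; case: (nlt _ _ _ _ h).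
Qed.

(** Since [zip] truncates, arguments from an initial part of [bs] are included too, which only makes
    avoidance stronger. *)
Definition trace (L K : Type) (f : L -> K -> I) (p : code) (bs : seq L) : set I :=
  [set y | exists is_ : seq K, decode p [seq f q.1 q.2 | q <- zip bs is_] y].

Lemma trace_leT L K (f : L -> K -> I) p bs : leT (set_type (trace f p bs)) (seq K).
Proof.
have h (y : set_type (trace f p bs)) : exists is_ : seq K,
    decode p [seq f q.1 q.2 | q <- zip bs is_] (val y) by exact: (set_mem (valP y)).
pose is_ y := projT1 (cid (h y)).
have is_P y : decode p [seq f q.1 q.2 | q <- zip bs (is_ y)] (val y).
  exact: projT2 (cid (h y)).
exists is_ => y y' e; apply/val_inj/(decode_inj (is_P y)).
by rewrite e; exact: is_P.
Qed.

(** With no arguments a code can list the cuts containing [y]. Avoidance for the empty list thus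
    makes fibres small. *)
Lemma trace_point L K (f : L -> K -> I) y : exists p, trace f p [::] y.
Proof.
exists (true, fun q => P q.2 y), [::] => c /=; split.
  by move=> /eqP Pc; exists [::].
by move=> [cs [-> _]].
Qed.

(** * Realizing a prescribed pattern *)

Section Entangled.
Variables (k : cardinal) (lam : linorder) (f : lam -> k -> I).
Hypothesis kreg : regular_card k.
Hypothesis small_cuts : ~ leT k (seq (E * bool) * E).
Hypothesis avoid : forall al p bs, all (< al) bs ->
  ~ big k [set i | trace f p bs (f al i)].

Variable k' : cardinal.
Hypotheses (kk' : leT k k') (k'k : leT k' k).

(** One coordinate: an index [al], the map choosing preimages under [f al], and the direction
    demanded there. *)
Local Notation row := (lam * (k' -> k) * bool)%type.
Implicit Types (l : row) (L : seq row) (z x : k').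

Let pt l z := f l.1.1 (l.1.2 z).

Definition pattern L z x :=
  all (fun l => if l.2 then pt l z < pt l x else pt l x < pt l z) L.

(** A box is a list of cut conditions, one per row, oriented by the row's direction. [outbox] asks
    every condition to fail, so that the pattern holds exactly when some box contains [z] and has
    [x] outside. *)
Let inbox cs L z := all2 (fun q l => (q.2 == l.2) && sat q (pt l z)) cs L.
Let outbox cs L z := all2 (fun q l => ~~ sat q (pt l z)) cs L.

Let pattern_box L z x :
  pattern L z x -> exists2 cs, inbox cs L z & outbox cs L x.
Proof.
elim: L => [|[[al i] w] L IH] /=; first by exists [::].
case/andP=> h /IH[cs csz csx].
suff [q h1 h2] : exists2 q, (q.2 == w) && sat q (pt (al, i, w) z) & ~~ sat q (pt (al, i, w) x).
  by exists (q :: cs); rewrite /inbox /outbox /= ?h1 ?h2.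
case: w h => /= /Psep[c Pc nPc]; [exists (c, true)|exists (c, false)];
  by rewrite /sat /= ?Pc ?(negbTE nPc).
Qed.

Let box_pattern cs L z x : inbox cs L z -> outbox cs L x -> pattern L z x.
Proof.
elim: cs L => [|[c b] cs IH] [|[[al i] w] L] //= /andP[/andP[/eqP /= -> s1] h1] /andP[s2 h2].
apply/andP; split; last exact: IH.
move: s1 s2; rewrite /sat /=; case: w; first by rewrite !eqb_id; exact: cut_lt.
by rewrite !eqbF_neg negbK => nPz Px; exact: cut_lt Px nPz.
Qed.

(** Rows come with decreasing index, so the head belongs to the newest function, which avoids what
    is decoded from the tail. The induction ranges over all big [G], as it is applied to the sets
    [Gc c]. *)
Lemma pattern_realized L (G : set k') : big k G ->
  pairwise (fun l l' => l'.1.1 < l.1.1) L ->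
  all (fun l => `[< {in G &, injective l.1.2} >]) L ->
  exists z x, [/\ G z, G x, z < x & pattern L z x].
Proof.
elim: L G => [|[[al i] w] L IH] G bG.
  move=> _ _; have [g gi gG] := bG; have [n ni] := regular_infinite kreg.
  have : g (n 0%N) != g (n 1%N) by apply/eqP => /gi/ni.
  by case/lt_total/orP => h; [exists (g (n 0%N)), (g (n 1%N))|exists (g (n 1%N)), (g (n 0%N))].
rewrite [pairwise _ _]/= => /andP[ltL pwL] /= /andP[/asboolP iinj injL].
apply: contrapT => none.
pose l0 : row := (al, i, w).
(* [p] will record which pairs of a box for the tail and a cut for the head, taken on side [w], are
   realised in [G]. *)
pose wit (r : seq (E * bool) * E) z :=
  [/\ G z, inbox r.1 L z & P r.2 (pt l0 z) == w].
pose p : code := (w, fun r => `[< exists z, wit r z >]).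
have [g0 _ gG0] := bG; have [n0 _] := regular_infinite kreg.
(* One realising index is chosen per pair, with an arbitrary default for unrealised pairs; there are
   fewer than [k] pairs, so a single [b] bounds all choices. *)
have pick r : exists z, (exists z, wit r z) -> wit r z.
  by have [[z zP]|nz] := pselect (exists z, wit r z); [exists z|exists (g0 (n0 0%N))].
pose eta r := projT1 (cid (pick r)).
have etaP r : (exists z, wit r z) -> wit r (eta r) by exact: projT2 (cid (pick r)).
have [b eta_lt] := small_image_bounded kreg eta kk' k'k small_cuts.
have nE : ~ leT k E.
  move=> kE; apply: small_cuts; apply: leT_trans kE _.
  by exists (fun e => ([::], e)) => e e' [].
(* [Gc c] holds the indices where [p] misses the cut [c]. Were it big, induction would give [z < x]
   in it with the tail pattern; a box containing [z] with [x] outside, paired with [c], is realised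
   by [z], so [p] detects [c] at [x]. *)
pose Gc c := [set z | [/\ G z, P c (pt l0 z) == w &
  ~ exists cs, p.2 (cs, c) /\ outbox cs L z]].
have Gc_small c : ~ big k (Gc c).
  move=> bGc; have [||z [x [[Gz Pz _] [_ _ nx] _ /pattern_box[cs hz hx]]]] := IH (Gc c) bGc.
  - exact: pwL.
  - apply: sub_all injL => l /asboolP inj; apply/asboolP => z x /set_mem[Gz _ _] /set_mem[Gx _ _].
    by apply: inj; exact/mem_set.
  by apply: nx; exists cs; split=> //; apply/asboolP; exists z.
(* At each remaining index [p] decodes the head from the tail, which contradicts [avoid]. *)
have bG' : big k ((G `\` [set z | z < b]) `\` [set z | exists c, Gc c z]).
  apply: big_setI_compl => //; last exact: small_bigcup.
  by apply: big_setI_compl => //; exact: bounded_small.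
apply: (@avoid al p [seq l.1.1 | l <- L]); first by rewrite all_map.
apply: (big_inj (h := i) _ _ bG').
  by move=> z x /set_mem[[Gz _] _] /set_mem[[Gx _] _]; apply: iinj; exact/mem_set.
move=> z [[Gz /= nzb] nGc]; exists [seq l.1.2 z | l <- L].
have -> : [seq f q.1 q.2 | q <- zip [seq l.1.1 | l <- L] [seq l.1.2 z | l <- L]]
    = [seq pt l z | l <- L] by elim: (L) => //= l L' ->.
move=> c; rewrite -[f al _]/(pt l0 z); split.
  move=> Pc; apply: contrapT => H; apply: nGc; exists c; split=> //.
  by move=> [cs [pcs out]]; apply: H; exists cs; rewrite all2_map_r.
(* The realising index [y] is below [b], hence below [z], and the box gives the tail pattern. As the
   full pattern is omitted, the heads are in the wrong order, which puts the head at [z] on side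
   [w]. *)
move=> [cs []]; rewrite all2_map_r => /asboolP/etaP.
set y := eta _ => -[Gy yin Py] zout.
have yz : y < z by apply: lt_le_trans (eta_lt _) _; rewrite leNgt; exact/negP.
have : ~~ pattern (l0 :: L) y z.
  by apply/negP => pat; apply: none; exists y, z.
rewrite /= (box_pattern yin zout) andbT.
move: Py => /=; case: (w) => /=; rewrite -leNgt => /eqP Py zy.
  by rewrite (Pdown zy).
by apply/eqP/negbTE/negP => /(Pdown zy); rewrite Py.
Qed.

End Entangled.
End Cuts.

(** * Power sets, finite types and well-foundedness *)

Lemma leT_powerset A B : leT A B -> leT (A -> bool) (B -> bool).
Proof.
move=> [j ji]; exists (fun p b => `[< exists2 a, j a = b & p a >]) => p q e.
apply/funext => a; have /= := congr1 (@^~ (j a)) e.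
have jE (r : A -> bool) : `[< exists2 a', j a' = j a & r a' >] = r a.
  by apply/asboolP/idP => [[a' /ji -> //]|ra]; exists a.
by rewrite !jE.
Qed.

Lemma leT_pred A : leT A (A -> bool).
Proof.
exists (fun a b => `[< a = b >]) => a b e.
have /= := congr1 (@^~ b) e.
by rewrite (asboolT (erefl b)) => /asboolP.
Qed.

Lemma finite_leT A : ~ leT nat A -> exists n, leT A 'I_n.
Proof.
move=> nA; have /finite_setP[n An] : finite_set [set: A].
  by apply/finite_setPn => /leTP.
exists n; apply/leTP; move: (card_eq_trans An card_II).
by case/card_eqPle.
Qed.

Lemma card_eq_leT A B : [set: A] #= [set: B] <-> leT A B /\ leT B A.
Proof.
by split=> [/card_eqPle[/leTP ? /leTP ?]|[/leTP ? /leTP ?]] //; apply/card_eqPle.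
Qed.

Lemma cardinal_lt_wf (c : cardinal) : well_founded (fun x y : c => x < y).
Proof.
move=> x; apply: contrapT => nx.
have [|m [[/asboolP mA mmin] _]] := @cardinal_wo c (fun y => `[< ~ Acc (fun x y : c => x < y) y >]).
  by exists x; exact/asboolP.
apply: mA; constructor => y ym; apply: contrapT => ny.
by have := mmin y (introT (asboolP _) ny); rewrite leNgt ym.
Qed.

(** * Recursive choice of avoiding functions *)

Section Avoid.
Variables (k chi lam : cardinal).
Hypotheses (kreg : regular_card k) (kchi : leT k chi).
Hypothesis lamU : leT lam (UJ (bounded_ideal k) chi).

(** Otherwise the sets [A x], enlarged by a fixed copy of [k] to have size exactly [k], form a
    family as in the definition of [UJ], whence [lam] embeds in [X]. *)
Lemma avoiding_function (X : Type) (A : X -> set chi) : ~ leT lam X ->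
  (forall x, leT (set_type (A x)) k) ->
  exists g : k -> chi, forall x, bounded_ideal k [set i | A x (g i)].
Proof.
move=> lamX Ak; apply: contrapT => /forallNP H; apply: lamX.
have [j ji] := kchi; pose B x := range j `|` A x.
have [c Bc] := cardinal_exists (set_type (range B)).
apply: leT_trans lamU _.
apply: (leT_trans (B := c)); last first.
  apply: leT_trans (leT_range B (leT_refl X)).
  by have /card_eq_leT[] := Bc.
apply/leTP; rewrite /UJ; set p := (X in least_card X).
have pc : p c.
  exists (range B); split; last exact: card_eq_trans (card_esym (card_setT _)) Bc.
  - move=> _ [x _ <-]; apply: card_eq_trans (card_esym (card_setT _)) _.
    apply/card_eq_leT; split.
      apply: leT_trans (leT_setU _ _) _; apply: leT_sum_absorb => //.
        exact: regular_infinite.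
      by apply: leT_range; exact: leT_refl.
    apply: leT_trans (leT_range_inj ji) _; apply: leT_subset.
    exact: subsetUl.
  - move=> g; have /existsNP[x nb] := H g; exists (B x); split; first by exists x.
    move=> [b bP]; apply: nb; exists b => i Ai; apply: bP; right; exact: Ai.
by have [_] := @least_cardP p (ex_intro _ c pc); exact.
Qed.

Variables (mu : cardinal) (I : linorder) (E : Type) (P : E -> I -> bool).
Hypothesis Pdown : forall c x y, x <= y -> P c y -> P c x.
Hypothesis Psep : forall x y, x < y -> exists2 c, P c x & ~~ P c y.
Hypotheses (mu_inf : leT nat mu) (E_mu : leT (seq (E * bool) * E) mu).
Hypotheses (lam_mu : ~ leT lam (mu -> bool)) (chiI : leT chi I).

Lemma code_le : leT (code E) (mu -> bool).
Proof.
have inf : leT nat (mu -> bool) by exact: leT_trans mu_inf (leT_pred _).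
apply: leT_prod_absorb => //; last exact: leT_powerset.
exact: leT_trans (leT_countType _) inf.
Qed.

(** If the set [S] of earlier indices embeds in [mu -> bool], so does the product, and [lam] does
    not. Otherwise the product embeds in [S], and [lam] is an initial ordinal. *)
Lemma initial_codes_lt (al : lam) :
  ~ leT lam (code E * seq (set_type [set be | be < al])).
Proof.
set S := set_type _ => H.
have inf : leT nat (mu -> bool) by exact: leT_trans mu_inf (leT_pred _).
have [SM|MS] := leT_total S (mu -> bool).
  apply: lam_mu; apply: leT_trans H _; apply: leT_prod_absorb => //.
    exact: code_le.
  exact: leT_seq_absorb.
have infS : leT nat S by exact: leT_trans inf MS.
apply: (@cardinal_initial _ al).
rewrite -(card_le_eqr (card_setT _)); apply/leTP.
apply: leT_trans H _; apply: leT_prod_absorb => //.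
  exact: leT_trans code_le MS.
exact: leT_seq_absorb (leT_refl S).
Qed.

Let avoids (al : lam) (h : lam -> k -> I) (g : k -> I) :=
  forall p bs, all (< al) bs -> ~ big k [set i | trace P h p bs (g i)].

Let avoids_exists al h : exists g, avoids al h g.
Proof.
have [v vi] := chiI.
have [|g gP] := @avoiding_function _ (fun x : code E * seq (set_type [set be | be < al]) =>
    v @^-1` trace P h x.1 (map val x.2)) (@initial_codes_lt al).
  move=> [p bs]; apply: (leT_trans (B := set_type (trace P h p (map val bs)))).
    have vA (y : set_type (v @^-1` trace P h p (map val bs))) :
        trace P h p (map val bs) (v (val y)) by exact: (set_mem (valP y)).
    by exists (fun y => set_elt (vA y)) => y y' /(congr1 val)/= /vi/val_inj.
  apply: leT_trans (trace_leT Psep _ _ _) _.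
  exact: leT_seq_absorb (regular_infinite kreg) (leT_refl k).
exists (v \o g) => p bs bsal.
have [bs' ->] : exists bs' : seq (set_type [set be | be < al]), bs = map val bs'.
  elim: bs bsal => [|be bs IH] /=; first by exists [::].
  move=> /andP[beal /IH[bs' ->]].
  by exists (@set_elt _ [set be | be < al] be beal :: bs').
have [b bP] := gP (p, bs'); move=> /(big_sub bP).
exact: bounded_small (leT_refl k).
Qed.

Lemma avoiding_family : exists f : lam -> k -> I, forall al p bs,
  all (< al) bs -> ~ big k [set i | trace P f p bs (f al i)].
Proof.
have [v _] := chiI; have [j _] := kchi.
(* The default [v \o j] is harmless: a trace at stage [al] consults only indices below [al]. *)
pose ext al (rec : forall be : lam, be < al -> k -> I) be :=
  match pselect (be < al) with left h => rec be h | right _ => v \o j end.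
pose step al rec := projT1 (cid (avoids_exists al (ext al rec))).
have stepP al rec : avoids al (ext al rec) (step al rec).
  exact: projT2 (cid (avoids_exists al (ext al rec))).
pose f := Fix (@cardinal_lt_wf lam) (fun=> k -> I) step.
have fE al : f al = step al (fun be _ => f be).
  rewrite /f Fix_eq // => x g1 g2 g12; congr (step x _).
  by apply/functional_extensionality_dep => be; apply/funext => h; exact: g12.
exists f => al p bs bsal; rewrite [in f al]fE.
have -> : trace P f p bs = trace P (ext al (fun be _ => f be)) p bs.
  apply/funext => y; rewrite /trace /=.
  suff e is_ : [seq f q.1 q.2 | q <- zip bs is_] =
      [seq ext al (fun be _ => f be) q.1 q.2 | q <- zip bs is_].
    by apply/propext; split=> -[is_ d]; exists is_; move: d; rewrite e.
  elim: bs bsal is_ => [|be bs IH] /= => [_ [] //|/andP[beal /IH{}IH] [|i is_] //=].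
  by rewrite IH /ext; case: pselect.
exact: stepP.
Qed.

End Avoid.

(** * Density, and orders with adjoined jumps *)

Lemma density_le (I : linorder) (D : set I) A :
  dense_subset D -> leT (set_type D) A -> leT (density I) A.
Proof.
move=> Ddense DA; have [c Dc] := cardinal_exists (set_type D).
have Dc' : D #= [set: c] by exact: card_eq_trans (card_esym (card_setT _)) Dc.
have cD : leT c (set_type D) by have /card_eq_leT[] := Dc.
apply: leT_trans (leT_trans cD DA); apply/leTP.
pose p c := exists D : set I, dense_subset D /\ D #= [set: c].
have pc : p c by exists D.
by have [_] := @least_cardP p (ex_intro _ c pc); exact.
Qed.

Lemma density_attained (I : linorder) :
  exists2 D : set I, dense_subset D & leT (set_type D) (density I).
Proof.
have [c Ic] := cardinal_exists (set_type [set: I]).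
pose p c := exists D : set I, dense_subset D /\ D #= [set: c].
have pc : p c.
  exists setT; split; last exact: card_eq_trans (card_esym (card_setT _)) Ic.
  by move=> x y xy; exists x; split=> //; exact: ltW.
have [[D [Dd /(card_eq_trans (card_setT _))/card_eq_leT[DI _]]] _] :=
  @least_cardP p (ex_intro _ c pc).
by exists D.
Qed.

(** Density does not pass to [A] by intersection. Instead one chooses a point of [A] between any two
    cuts where there is one, and the last point of [A] inside each cut where it exists; the latter
    handles the jumps of [A]. *)
Lemma dense_of_cuts (I : linorder) (E : Type) (P : E -> I -> bool) (A : set I) :
  (forall c x y, x <= y -> P c y -> P c x) ->
  (forall x y, x < y -> exists2 c, P c x & ~~ P c y) ->
  exists D : set I, [/\ D `<=` A, leT (set_type D) (E * E + E) &
    forall x y, A x -> A y -> x < y -> exists z, [/\ D z, x <= z & z <= y]].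
Proof.
move=> Pdown Psep.
pose good (e : E * E + E) z := A z /\ match e with
  | inl (c, c') => ~~ P c z /\ P c' z
  | inr c => P c z /\ forall u, A u -> P c u -> u <= z
  end.
have hE e : exists o : option I,
    (exists z, good e z) -> exists2 z, o = Some z & good e z.
  have [[z gz]|ng] := pselect (exists z, good e z); last by exists None.
  by exists (Some z) => _; exists z.
pose h e := projT1 (cid (hE e)).
have hP e : (exists z, good e z) -> exists2 z, h e = Some z & good e z.
  exact: projT2 (cid (hE e)).
pose D : set I := [set z | A z /\ exists e, h e = Some z].
exists D; split; first by move=> z [].
  have De (z : set_type D) : exists e, h e = Some (val z).
    by have /set_mem[] := valP z.
  pose e z := projT1 (cid (De z)).
  have eP z : h (e z) = Some (val z) by exact: projT2 (cid (De z)).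
  by exists e => z z' ee; apply/val_inj/Some_inj; rewrite -!eP ee.
move=> x y Ax Ay xy.
have [[u [Au xu uy]]|none] := pselect (exists u, [/\ A u, x < u & u < y]).
  have [c cx cu] := Psep _ _ xu; have [c' c'u c'y] := Psep _ _ uy.
  have [|z hz [Az [ncz c'z]]] := hP (inl (c, c')); first by exists u.
  exists z; split; first by split=> //; exists (inl (c, c')).
    exact/ltW/(cut_lt Pdown cx).
  exact/ltW/(cut_lt Pdown c'z).
have [c cx cy] := Psep _ _ xy.
have xmax u : A u -> P c u -> u <= x.
  move=> Au cu; rewrite leNgt; apply/negP => xu; apply: none; exists u.
  by split=> //; exact: (cut_lt Pdown cu).
have [|z hz [Az [cz zmax]]] := hP (inr c); first by exists x.
exists z; split; first by split=> //; exists (inr c).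
  exact: zmax.
exact: le_trans (xmax _ Az cz) (ltW xy).
Qed.

(* The jumps [(m, false) < (m, true)] force the density to be at least that of mu,
   even when the part inside [I] has a smaller dense subset. *)
Section WithJumps.
Variables (I : linorder) (A : set I) (mu : cardinal).

Let T := (set_type A + mu * bool)%type.

Let R : rel T := fun u v => match u, v with
  | inl x, inl y => val x <= val y
  | inl _, inr _ => true
  | inr _, inl _ => false
  | inr p, inr q => (p.1 < q.1) || (p.1 == q.1) && (p.2 ==> q.2)
  end.

Let R_anti : antisymmetric R.
Proof.
move=> [x|[m b]] [y|[n c]] //=; first by move=> /le_anti/val_inj ->.
case: (ltgtP m n) => //= -> /andP[bc cb].
by congr (inr (_, _)); move: bc cb; case: b; case: c.
Qed.

Let R_trans : transitive R.
Proof.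
move=> [y|[n c]] [x|[m b]] [z|[p d]] //=; first exact: le_trans.
case: (ltgtP m n) => //= [mn _|<-].
  by case/orP => [np|/andP[/eqP <- _]]; rewrite ?(lt_trans mn np) ?mn.
case: (ltgtP m p) => //= _.
by case: b; case: c; case: d.
Qed.

Let R_total : total R.
Proof.
move=> [x|[m b]] [y|[n c]] //=; first exact: le_total.
by case: (ltgtP m n) => //= _; case: b; case: c.
Qed.

Definition with_jumps : linorder := wo_type R_anti R_trans R_total.

Definition wj_old (x : set_type A) : with_jumps := inl x.

Lemma wj_lt (x y : set_type A) : (wj_old x < wj_old y) = (val x < val y).
Proof.
rewrite lt_neqAle [RHS]lt_neqAle; congr (~~ _ && _).
by apply/eqP/eqP => [[->]|/val_inj ->].
Qed.

Definition wj_new (p : mu * bool) : with_jumps := inr p.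

Lemma wj_new_le p q : (wj_new p <= wj_new q) =
  (p.1 < q.1) || (p.1 == q.1) && (p.2 ==> q.2).
Proof. by []. Qed.

Lemma wj_card (k : cardinal) : leT nat k -> leT mu k -> leT (set_type A) k ->
  leT k (set_type A) -> [set: with_jumps] #= [set: k].
Proof.
move=> kinf muk Ak kA; apply/card_eq_leT; split.
  apply: leT_sum_absorb => //; apply: leT_prod_absorb => //.
  exact: leT_trans (leT_countType _) kinf.
by apply: leT_trans kA _; exists inl => x y [].
Qed.

(** Upper bound: [D] with all jump points is dense. Lower bound: a dense set contains an endpoint of
    every jump, and distinct jumps share none. *)
Lemma wj_density (D : set I) : leT nat mu -> D `<=` A -> leT (set_type D) mu ->
  (forall x y, A x -> A y -> x < y -> exists z, [/\ D z, x <= z & z <= y]) ->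
  [set: density with_jumps] #= [set: mu].
Proof.
move=> muinf DA Dmu Ddense; apply/card_eq_leT; split.
  pose D' : set with_jumps := [set u | match (u : T) with
     | inl x => D (val x) | inr _ => True end].
  apply: (@density_le _ D').
    move=> [x|p] [y|q] // xy.
    - have [z [Dz xz zy]] := Ddense _ _ (set_mem (valP x)) (set_mem (valP y)) (etrans (esym (wj_lt x y)) xy).
      by exists (wj_old (set_elt (DA _ Dz))).
    - by exists (inr q); split => //; exact: ltW.
    - by exists (inr p); split => //; exact: ltW.
    - by exists (inr p); split => //; exact: ltW.
  apply: (leT_trans (B := set_type D + mu * bool)).
    have h (u : set_type D') : exists v : set_type D + mu * bool,
       match (val u : T) with inl x => exists2 d, v = inl d & val d = val x
                            | inr p => v = inr p end.
      have := set_mem (valP u); rewrite /D' /=; case: (val u : T) => [x Dx|p _].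
        by exists (inl (set_elt Dx)), (set_elt Dx).
      by exists (inr p).
    pose g u := projT1 (cid (h u)).
    exists g => u u' e; apply: val_inj.
    have := projT2 (cid (h u)); have := projT2 (cid (h u')).
    rewrite -/(g u) -/(g u') e.
    case: (val u : T) => [x|p]; case: (val u' : T) => [x'|p'].
    - by move=> [d' -> d'x'] [d [<-] dx]; congr inl; apply: val_inj; rewrite -dx -d'x'.
    - by move=> -> [].
    - by move=> [d' -> _].
    - by move=> -> [->].
  apply: leT_sum_absorb => //; apply: leT_prod_absorb => //; first exact: leT_refl.
  exact: leT_trans (leT_countType _) muinf.
have [D' dense' le'] := density_attained with_jumps.
apply: leT_trans le'.
have jump (m : mu) : exists u : set_type D', exists b, val u = inr (m, b) :> T.
  have [|z [D'z]] := dense' (wj_new (m, false)) (wj_new (m, true)).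
    by rewrite lt_neqAle wj_new_le /= eqxx orbT andbT; apply/eqP => -[].
  case: z D'z => [z|[n b]] D'z //; rewrite !(wj_new_le _ (_, _)) /= => mn nm.
  exists (set_elt D'z), b => /=; congr (inr (_, _)).
  by move: mn nm; case: (ltgtP m n).
pose g m := projT1 (cid (jump m)).
have gP m : exists b, val (g m) = inr (m, b) :> T by exact: projT2 (cid (jump m)).
by exists g => m n e; have [b] := gP m; have [c] := gP n; rewrite e => -> [].
Qed.

End WithJumps.

(** * Entanglement of the ranges with jumps *)

Section Assembly.
Variables (mu k lam : cardinal) (I : linorder) (E : Type) (P : E -> I -> bool).
Hypothesis Pdown : forall c x y, x <= y -> P c y -> P c x.
Hypothesis Psep : forall x y, x < y -> exists2 c, P c x & ~~ P c y.
Hypotheses (kreg : regular_card k) (mu_inf : leT nat mu).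
Hypotheses (muk : leT mu k) (nkmu : ~ leT k mu).
Hypothesis E_mu : leT (seq (E * bool) * E) mu.
Variable f : lam -> k -> I.
Hypothesis avoid : forall al p bs, all (< al) bs ->
  ~ big k [set i | trace P f p bs (f al i)].

Local Notation J al := (with_jumps (range (f al)) mu).

Lemma range_card al : leT k (set_type (range (f al))).
Proof.
apply: preimage_small_inj => // y bad.
have [p py] := trace_point P f y.
apply: (@avoid al p [::]) => //; by apply: big_sub bad => i /= ->.
Qed.

Lemma ranges_entangled : lam -> entangled (fun al : lam => J al).
Proof.
move=> al0.
have Jk al : [set: J al] #= [set: k].
  apply: wj_card => //; [exact: regular_infinite| |exact: range_card].
  by apply: leT_range; exact: leT_refl.
rewrite /entangled /=; set k' := least_card _.
(* The index [al0] ensures that the minimum is attained, so [k'] is equipotent with [k]. *)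
have [[al1 Jk'] _] := @least_cardP (fun c => exists al, [set: J al] #= [set: c])
  (ex_intro _ k (ex_intro _ al0 (Jk al0))).
rewrite -/k' in Jk'.
have [kk' k'k] : leT k k' /\ leT k' k.
  by apply/card_eq_leT; exact: card_eq_trans (card_esym (Jk al1)) Jk'.
split=> [al|n al t al_incr t_inj w].
  apply/leTP; apply: leT_trans k'k _.
  by have /card_eq_leT[] := Jk al.
(* Jump points have no preimage and get an arbitrary index; only [z] in [G] will matter. *)
have idx_ex l z : exists i, forall u, t l z = wj_old mu u -> f (al l) i = val u.
  have [[u tu]|nu] := pselect (exists u, t l z = wj_old mu u).
    have [i _ fi] := set_mem (valP u); exists i => u'; rewrite tu => -[<-] //.
  have [n0 _] := regular_infinite kreg; have [g gi] := range_card al0.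
  by exists (n0 0%N) => u tu; case: nu; exists u.
pose idx l z := projT1 (cid (idx_ex l z)).
have idxP l z u : t l z = wj_old mu u -> f (al l) (idx l z) = val u.
  exact: (projT2 (cid (idx_ex l z)) u).
(* There are only mu jump points and each [t l] is injective, so each of the finitely many
   coordinates excludes fewer than [k] indices. *)
pose G := [set z | forall l, exists u, t l z = wj_old mu u].
have kmub : ~ leT k (mu * bool).
  move=> H; apply/nkmu/(leT_trans H)/leT_prod_absorb => //; first exact: leT_refl.
  exact: leT_trans (leT_countType _) mu_inf.
have bigG : big k G.
  pose bad := [set z | exists l, exists p, t l z = wj_new _ p].
  have nbad : ~ big k bad.
    apply: small_bigcup => // [|l].
      by move=> /(leT_trans (regular_infinite kreg)) /leTP/infiniteP; apply; exact: finite_finset.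
    move=> [g gi gP]; apply: kmub.
    pose h i := projT1 (cid (gP i)).
    have hP i : t l (g i) = wj_new _ (h i) by exact: projT2 (cid (gP i)).
    exists h => i j hij; apply/gi; apply: contrapT => /(t_inj l); apply.
    by rewrite !hP hij.
  have bigT : big k [set: k'] by have [g gi] := kk'; exists g.
  apply: big_sub (big_setI_compl kreg bigT nbad) => z [_ nz] l.
  case e : (t l z : (_ + _)%type) => [u|p]; first by exists u.
  by case: nz; exists l, p.
(* [rev] yields the decreasing order of indices that [pattern_realized] demands. *)
pose L := [seq (al l, idx l, l \in w) | l <- rev (enum 'I_n)].
have := @pattern_realized I E P Pdown Psep k lam f kreg _ avoid k' kk' k'k L G bigG.
case=> [||| z [x [Gz Gx zx]]].
- by move=> /leT_trans/(_ E_mu).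
- rewrite pairwise_map.
  apply: (@sub_pairwise _ (fun l m : 'I_n => (m < l)%N)).
    by move=> l m; exact: al_incr.
  rewrite -sorted_pairwise; last by move=> l m p /= ml lp; exact: ltn_trans lp ml.
  by rewrite rev_sorted -(sorted_map (f := val) (e' := ltn)) val_enum_ord iota_ltn_sorted.
- rewrite all_map; apply/allP => l _ /=; apply/asboolP => z x /set_mem Gz /set_mem Gx e.
  have [u tz] := Gz l; have [v tx] := Gx l.
  apply: contrapT => /(t_inj l); apply; rewrite tz tx; congr wj_old; apply: val_inj.
  by rewrite -(idxP _ _ _ tz) -(idxP _ _ _ tx) e.
rewrite /pattern all_map => /allP pat; exists z, x.
have {}pat l : if l \in w then t l z < t l x else t l x < t l z.
  have [u tz] := Gz l; have [v tx] := Gx l.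
  have := pat l; rewrite mem_rev mem_enum /= => /(_ isT).
  by rewrite (idxP _ _ _ tz) (idxP _ _ _ tx) tz tx !wj_lt.
split=> // l lw; have := pat l; first by rewrite lw.
by rewrite (negbTE lw).
Qed.

End Assembly.

(** * Choice of the linear order and conclusion *)

Theorem theorem3p1 (mu kappa chi lambda : cardinal)
    (hmukappa : [set: mu] #< [set: kappa])
    (hkappachi : [set: kappa] #< [set: chi])
    (hchiDed : [set: chi] #< [set: Ded_plus mu])
    (hmulambda : [set: mu -> bool] #< [set: lambda])
    (hkappareg : regular_card kappa)
    (hlambdaU : [set: lambda] #<= [set: UJ (bounded_ideal kappa) chi]) :
  Ens kappa lambda /\
  exists I : lambda -> linorder,
    Ens_witness kappa I /\
    forall al : lambda, [set: density (I al)] #= [set: mu].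
Proof.
suff [I [wI dI]] : exists I : lambda -> linorder,
    Ens_witness kappa I /\ forall al : lambda, [set: density (I al)] #= [set: mu].
  by split; [exists I|exists I].
have [/leTP muk nkmu'] := hmukappa; have {nkmu'}nkmu : ~ leT kappa mu by move=> /leTP.
have [/leTP kchi _] := hkappachi.
have [_ nlm] := hmulambda; have {nlm}lam_mu : ~ leT lambda (mu -> bool) by move=> /leTP.
have lamU : leT lambda (UJ (bounded_ideal kappa) chi) by apply/leTP.
(* Otherwise [chi] would lie in the class whose least member is [Ded_plus mu]. *)
have [I [chiI_eq Idens]] : exists I : linorder,
    [set: I] #= [set: chi] /\ [set: density I] #<= [set: mu].
  apply: contrapT => nI; have [_] := hchiDed; apply.
  pose p theta := ~ exists I : linorder,
    [set: I] #= [set: theta] /\ [set: density I] #<= [set: mu].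
  by have [_] := @least_cardP p (ex_intro _ chi nI); exact.
have [_ chiI] : leT I chi /\ leT chi I by exact/card_eq_leT.
have [D0 D0dense D0le] := density_attained I.
have D0mu : leT (set_type D0) mu by apply: leT_trans D0le _; exact/leTP.
pose E := (set_type D0 * bool)%type.
(* Each dense point gives a closed and an open cut, because the point supplied by [dense_subset] for
   [x < y] may be [x] or [y] itself. *)
pose P (e : E) (x : I) := if e.2 then x <= val e.1 else x < val e.1.
have Pdown c x y : x <= y -> P c y -> P c x.
  by move=> xy; rewrite /P; case: c.2; [exact: le_trans|exact: le_lt_trans].
have Psep x y : x < y -> exists2 c, P c x & ~~ P c y.
  move=> xy; have [z [Dz xz]] := D0dense _ _ xy; rewrite le_eqVlt => /predU1P[zy|zy].
    by exists (set_elt Dz, false); rewrite /P /= zy // ltxx.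
  by exists (set_elt Dz, true); rewrite /P /= // -ltNge.
have kinf := regular_infinite hkappareg.
(* For finite [mu] there would be finitely many cuts, hence finitely many points in [I], although
   the infinite [kappa] embeds in [I]. *)
have mu_inf : leT nat mu.
  apply: contrapT => /finite_leT[n mun].
  have IE : leT I (E -> bool).
    exists (fun x c => P c x) => x y e.
    have nlt u v : (fun c => P c u) = (fun c => P c v) -> ~ u < v.
      by move=> euv /Psep[c]; rewrite (congr1 (@^~ c) euv) => ->.
    by case: (ltgtP x y) => // /nlt; rewrite e => /(_ erefl).
  have EF : leT E ('I_n * bool)%type.
    exact: leT_prod (leT_trans D0mu mun) (leT_refl bool).
  have FF : leT ('I_n * bool -> bool) {ffun 'I_n * bool -> bool}.
    exists (fun g => [ffun c => g c]) => g h /ffunP gh; apply/funext => c.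
    by have := gh c; rewrite !ffunE.
  have := leT_trans kinf (leT_trans kchi (leT_trans chiI (leT_trans IE (leT_trans (leT_powerset EF) FF)))).
  by move=> /leTP/infiniteP; apply; exact: finite_finset.
have mub A : leT A mu -> leT (A * bool) mu.
  by move=> Amu; apply: leT_prod_absorb => //; exact: leT_trans (leT_countType _) mu_inf.
have Emu : leT E mu by exact: mub.
have E_mu : leT (seq (E * bool) * E) mu.
  by apply: leT_prod_absorb => //; apply: leT_seq_absorb => //; exact: mub.
have [f avoid] := avoiding_family hkappareg kchi lamU Psep mu_inf E_mu lam_mu chiI.
exists (fun al => with_jumps (range (f al)) mu); split; first split.
- move=> al; apply: wj_card => //; last exact: (range_card hkappareg avoid).
  by apply: leT_range; exact: leT_refl.
- have [al0] : inhabited lambda.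
    apply: contrapT => nl; apply: lam_mu.
    by exists (fun al _ => true) => al; case: nl; exists.
  exact: (ranges_entangled Pdown Psep).
- move=> al; have [D [DA Dle Ddense]] := dense_of_cuts (range (f al)) Pdown Psep.
  apply: (wj_density (D := D)) => //; apply: leT_trans Dle _.
  by apply: leT_sum_absorb => //; exact: leT_prod_absorb.
Qed.
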